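(* Let $\mathcal{V}$ be a Goursat (i.e. $3$-permutable) finitary quasivariety, and let $w_1,w_2$ be ternary terms of $\mathcal{V}$ satisfying the identities $$w_1(x,z,z)=x,\qquad w_1(x,x,z)=w_2(x,z,z),\qquad w_2(x,x,z)=z.$$ Then the sub-quasivariety $\mathcal{W}$ of $\mathcal{V}$ defined by the quasi-identity $$\left.\begin{aligned} &w_{1}(x,a,b)=w_{2}(a,b,c)=w_{1}(x',a,b)\\ &w_{2}(b,c,x)=w_{1}(a,b,c)=w_{2}(b,c,x')\end{aligned} \right\} \quad\Rightarrow\quad x=x'$$ is weakly Mal'tsev.
   Context: A (finitary) quasivariety is a class of algebras of a given finitary signature defined by identities and quasi-identities (finite conjunctions of term equations implying a term equation), regarded as a category with homomorphisms as morphisms. A finitary quasivariety $\mathcal{V}$ is Goursat, or $3$-permutable, if $RSR=SRS$ for any two equivalence relations $R$, $S$ in $\mathcal{V}$ on an object $A$; by a known result of Hagemann this is equivalent to the existence of ternary terms $w_1,w_2$ in $\mathcal{V}$ satisfying the identities displayed in the claim. A category is weakly Mal'tsev when it has pullbacks of split epimorphisms along split epimorphisms and, for all $f\colon A\to B$, $r\colon B\to A$, $g\colon C\to B$, $s\colon B\to C$ with $fr=1_B=gs$, the pair of morphisms $e_1=\langle 1_A,sf\rangle\colon A\to A\times_BC$, $e_2=\langle rg,1_C\rangle\colon C\to A\times_BC$ into the pullback of $f$ and $g$ is jointly epimorphic. *)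

(* Defs.v *)
From Stdlib Require Import ProofIrrelevance RelationClasses.
From mathcomp Require Import all_boot.

Set Implicit Arguments.
Unset Strict Implicit.
Unset Printing Implicit Defensive.

Record category := Category {
  obj : Type;
  hom : obj -> obj -> Type;
  idc : forall A, hom A A;
  catcomp : forall A B C, hom B C -> hom A B -> hom A C;
  catcomp_idl : forall A B (f : hom A B), catcomp (idc B) f = f;
  catcomp_idr : forall A B (f : hom A B), catcomp f (idc A) = f;
  catcomp_assoc : forall A B C D (h : hom C D) (g : hom B C) (f : hom A B),
    catcomp h (catcomp g f) = catcomp (catcomp h g) f }.

Arguments idc {c} A.
Arguments catcomp {c A B C} g f.

Declare Scope cat_scope.
Delimit Scope cat_scope with cat.
Notation "g \oc f" := (catcomp g f) (at level 40, left associativity) : cat_scope.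
Local Open Scope cat_scope.

Definition is_pullback (K : category) (A B C P : obj K)
    (f : hom A B) (g : hom C B) (p1 : hom P A) (p2 : hom P C) : Prop :=
  f \oc p1 = g \oc p2 /\
  forall (X : obj K) (a : hom X A) (c : hom X C), f \oc a = g \oc c ->
    exists! u : hom X P, p1 \oc u = a /\ p2 \oc u = c.

Definition jointly_epic (K : category) (A C P : obj K)
    (e1 : hom A P) (e2 : hom C P) : Prop :=
  forall (Z : obj K) (u v : hom P Z),
    u \oc e1 = v \oc e1 -> u \oc e2 = v \oc e2 -> u = v.

(* Pullbacks are determined up to isomorphism only, so the second clause
   ranges over every pullback [P] of [f] and [g]; the equations imposed on
   [e1] and [e2] say that [e1 = <1, s f>] and [e2 = <r g, 1>]. *)
Definition weakly_maltsev (K : category) : Prop :=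
  (forall (A B C : obj K) (f : hom A B) (r : hom B A)
          (g : hom C B) (s : hom B C),
     f \oc r = idc B -> g \oc s = idc B ->
     exists (P : obj K) (p1 : hom P A) (p2 : hom P C), is_pullback f g p1 p2)
  /\
  (forall (A B C : obj K) (f : hom A B) (r : hom B A)
          (g : hom C B) (s : hom B C),
     f \oc r = idc B -> g \oc s = idc B ->
     forall (P : obj K) (p1 : hom P A) (p2 : hom P C), is_pullback f g p1 p2 ->
     forall (e1 : hom A P) (e2 : hom C P),
       p1 \oc e1 = idc A -> p2 \oc e1 = s \oc f ->
       p1 \oc e2 = r \oc g -> p2 \oc e2 = idc C ->
       jointly_epic e1 e2).

Record signature := Signature { symbol : Type; arity : symbol -> nat }.

Record algebra (Sg : signature) := Algebra {
  carrier :> Type;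
  op : forall f : symbol Sg, ('I_(arity f) -> carrier) -> carrier }.

Arguments op {Sg} a f args.

Inductive term (Sg : signature) (X : Type) : Type :=
  | Var of X
  | App (f : symbol Sg) of ('I_(arity f) -> term Sg X).

Arguments Var {Sg X} x.
Arguments App {Sg X} f args.

Fixpoint eval (Sg : signature) (X : Type) (A : algebra Sg) (v : X -> A)
    (t : term Sg X) : A :=
  match t with
  | Var x => v x
  | App f args => op A f (fun i => eval v (args i))
  end.

Fixpoint subst (Sg : signature) (X Y : Type) (v : X -> term Sg Y)
    (t : term Sg X) : term Sg Y :=
  match t with
  | Var x => v x
  | App f args => App f (fun i => subst v (args i))
  end.

Definition ternary_term (Sg : signature) := term Sg 'I_3.

Definition app3 (Sg : signature) (X : Type) (w : ternary_term Sg)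
    (t0 t1 t2 : term Sg X) : term Sg X :=
  subst (tnth [tuple t0; t1; t2]) w.

Definition equation (Sg : signature) : Type := (term Sg nat * term Sg nat)%type.

Record quasi_identity (Sg : signature) := QuasiIdentity {
  premises : seq (equation Sg);
  conclusion : equation Sg }.

Definition identity_law (Sg : signature) (s t : term Sg nat) : quasi_identity Sg :=
  QuasiIdentity [::] (s, t).

Definition holds_at (Sg : signature) (A : algebra Sg) (v : nat -> A)
    (e : equation Sg) : Prop :=
  eval v e.1 = eval v e.2.

Fixpoint all_hold_at (Sg : signature) (A : algebra Sg) (v : nat -> A)
    (es : seq (equation Sg)) : Prop :=
  if es is e :: es' then holds_at v e /\ all_hold_at v es' else True.

Definition satisfies (Sg : signature) (A : algebra Sg)
    (q : quasi_identity Sg) : Prop :=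
  forall v : nat -> A, all_hold_at v (premises q) -> holds_at v (conclusion q).

(* A quasivariety is given by a set of defining quasi-identities, possibly
   infinite; the empty algebra belongs to it when [Sg] has no constants. *)
Record quasivariety (Sg : signature) := Quasivariety {
  axioms : quasi_identity Sg -> Prop }.

Definition in_quasivariety (Sg : signature) (V : quasivariety Sg)
    (A : algebra Sg) : Prop :=
  forall q, axioms V q -> satisfies A q.

Definition valid_in (Sg : signature) (V : quasivariety Sg)
    (q : quasi_identity Sg) : Prop :=
  forall A : algebra Sg, in_quasivariety V A -> satisfies A q.

Definition subquasivariety (Sg : signature) (V : quasivariety Sg)
    (q : quasi_identity Sg) : quasivariety Sg :=
  Quasivariety (fun q' => axioms V q' \/ q' = q).

Definition is_hom (Sg : signature) (A B : algebra Sg) (h : A -> B) : Prop :=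
  forall (f : symbol Sg) (a : 'I_(arity f) -> A),
    h (op A f a) = op B f (fun i => h (a i)).

Record homomorphism (Sg : signature) (A B : algebra Sg) := Homomorphism {
  hom_fun :> A -> B;
  hom_prop : is_hom hom_fun }.

Definition hom_id (Sg : signature) (A : algebra Sg) : homomorphism A A :=
  @Homomorphism Sg A A id (fun f a => erefl).

Lemma is_hom_comp (Sg : signature) (A B C : algebra Sg)
    (g : homomorphism B C) (h : homomorphism A B) :
  is_hom (fun x => g (h x)).
Proof. by move=> f a; rewrite (hom_prop h) (hom_prop g). Qed.

Definition hom_comp (Sg : signature) (A B C : algebra Sg)
    (g : homomorphism B C) (h : homomorphism A B) : homomorphism A C :=
  Homomorphism (is_hom_comp g h).

Lemma hom_eq (Sg : signature) (A B : algebra Sg) (g h : homomorphism A B) :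
  hom_fun g = hom_fun h -> g = h.
Proof.
case: g h => [g gP] [h hP] /= e; case: h / e hP => hP.
by rewrite (proof_irrelevance _ gP hP).
Qed.

Lemma hom_comp_idl (Sg : signature) (A B : algebra Sg) (h : homomorphism A B) :
  hom_comp (hom_id B) h = h.
Proof. exact: hom_eq. Qed.

Lemma hom_comp_idr (Sg : signature) (A B : algebra Sg) (h : homomorphism A B) :
  hom_comp h (hom_id A) = h.
Proof. exact: hom_eq. Qed.

Lemma hom_comp_assoc (Sg : signature) (A B C D : algebra Sg)
    (h : homomorphism C D) (g : homomorphism B C) (f : homomorphism A B) :
  hom_comp h (hom_comp g f) = hom_comp (hom_comp h g) f.
Proof. exact: hom_eq. Qed.

Definition quasivariety_category (Sg : signature) (V : quasivariety Sg) :
  category :=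
  {| obj := {A : algebra Sg | in_quasivariety V A};
     hom := fun A B => homomorphism (sval A) (sval B);
     idc := fun A => hom_id (sval A);
     catcomp := fun A B C g h => hom_comp g h;
     catcomp_idl := fun A B h => hom_comp_idl h;
     catcomp_idr := fun A B h => hom_comp_idr h;
     catcomp_assoc := fun A B C D h g f => hom_comp_assoc h g f |}.

(* Compatibility says that [R] is a subalgebra of the product of [A] with
   itself; it then lies in every quasivariety containing [A], so these are the
   internal equivalence relations.  They need not be kernel pairs in [V]: the
   quotient of [A] by [R] may fail to belong to [V]. *)
Definition compatible_equivalence (Sg : signature) (A : algebra Sg)
    (R : A -> A -> Prop) : Prop :=
  Equivalence R /\
  forall (f : symbol Sg) (a b : 'I_(arity f) -> A),
    (forall i, R (a i) (b i)) -> R (op A f a) (op A f b).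

Definition rel_comp (T : Type) (R S : T -> T -> Prop) : T -> T -> Prop :=
  fun x z => exists y, R x y /\ S y z.

Definition goursat (Sg : signature) (V : quasivariety Sg) : Prop :=
  forall A : algebra Sg, in_quasivariety V A ->
  forall R S : A -> A -> Prop,
    compatible_equivalence R -> compatible_equivalence S ->
  forall x y : A,
    rel_comp R (rel_comp S R) x y <-> rel_comp S (rel_comp R S) x y.

Definition goursat_terms (Sg : signature) (V : quasivariety Sg)
    (w1 w2 : ternary_term Sg) : Prop :=
  let x := Var 0 in let z := Var 1 in
  [/\ valid_in V (identity_law (app3 w1 x z z) x),
      valid_in V (identity_law (app3 w1 x x z) (app3 w2 x z z))
    & valid_in V (identity_law (app3 w2 x x z) z)].

Definition goursat_quasi_identity (Sg : signature) (w1 w2 : ternary_term Sg) :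
  quasi_identity Sg :=
  let x := Var 0 in let x' := Var 1 in
  let a := Var 2 in let b := Var 3 in let c := Var 4 in
  QuasiIdentity
    [:: (app3 w1 x a b, app3 w2 a b c);
        (app3 w2 a b c, app3 w1 x' a b);
        (app3 w2 b c x, app3 w1 a b c);
        (app3 w1 a b c, app3 w2 b c x')]
    (x, x').

(* Main.v *)
From Stdlib Require Import FunctionalExtensionality ProofIrrelevance.
Require Import Defs.
From mathcomp Require Import all_boot.

Set Implicit Arguments.
Unset Strict Implicit.
Unset Printing Implicit Defensive.

(** Write an element of the pullback as [(a, c)], with [b] the common image of
    [a] and [c], and put [p = (a, s b)], [q = (r b, s b)], [t = (r b, c)]; all
    three lie in the images of [e1] and [e2].  The Goursat identities, read
    componentwise, give
      w1((a, c), t, q) = w2(t, q, p)   and   w2(q, p, (a, c)) = w1(t, q, p),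
    so two homomorphisms that agree on [p], [q], [t] send [(a, c)] to two
    solutions of the premises of the quasi-identity, hence to the same
    element. *)

Section Terms.
Variable Sg : signature.

Lemma eval_hom X (A B : algebra Sg) (h : A -> B) (v : X -> A) t :
  is_hom h -> h (eval v t) = eval (fun x => h (v x)) t.
Proof.
move=> hP; elim: t => [//|f args IH] /=.
by rewrite hP; congr (op B f _); apply: functional_extensionality.
Qed.

Lemma eval_subst X Y (A : algebra Sg) (v : Y -> A) (s : X -> term Sg Y) t :
  eval v (subst s t) = eval (fun x => eval v (s x)) t.
Proof.
elim: t => [//|f args IH] /=.
by congr (op A f _); apply: functional_extensionality.
Qed.

Definition term_op3 (w : ternary_term Sg) (A : algebra Sg) (x y z : A) : A :=
  eval (tnth [tuple x; y; z]) w.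

Lemma map_tnth3 X Y (h : X -> Y) (x y z : X) :
  (fun i => h (tnth [tuple x; y; z] i)) = tnth [tuple h x; h y; h z].
Proof. by apply: functional_extensionality => -[[|[|[|i]]] lti]. Qed.

Lemma eval_app3 X (A : algebra Sg) (v : X -> A) w t0 t1 t2 :
  eval v (app3 w t0 t1 t2) = term_op3 w (eval v t0) (eval v t1) (eval v t2).
Proof. by rewrite eval_subst map_tnth3. Qed.

Lemma hom_term_op3 (A B : algebra Sg) (h : homomorphism A B) w x y z :
  h (term_op3 w x y z) = term_op3 w (h x) (h y) (h z).
Proof. by rewrite /term_op3 (eval_hom _ _ (hom_prop h)) map_tnth3. Qed.

Lemma all_hold_at_hom (A B : algebra Sg) (h : homomorphism A B) v es :
  all_hold_at v es -> all_hold_at (fun n => h (v n)) es.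
Proof.
elim: es => [//|e es IH] /= [ev /IH ?]; split=> //.
by rewrite /holds_at -!(eval_hom _ _ (hom_prop h)) ev.
Qed.

(** Homomorphisms carry the premises of a quasi-identity forward along [h] and [k]; its conclusion
    then holds in [A] and in [C], and joint injectivity brings it back to [D]. This is what places
    the fibre product in the quasivariety. *)
Lemma in_quasivariety_jointly_injective (V : quasivariety Sg)
    (D A C : algebra Sg) (h : homomorphism D A) (k : homomorphism D C) :
  (forall x y, h x = h y -> k x = k y -> x = y) ->
  in_quasivariety V A -> in_quasivariety V C -> in_quasivariety V D.
Proof.
move=> inj VA VC q Vq v prem; apply: inj.
  rewrite !(eval_hom _ _ (hom_prop h)).
  exact: VA Vq _ (all_hold_at_hom h prem).
rewrite !(eval_hom _ _ (hom_prop k)).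
exact: VC Vq _ (all_hold_at_hom k prem).
Qed.

End Terms.

Section Pullback.
Variables (Sg : signature) (A B C : algebra Sg).
Variables (f : homomorphism A B) (g : homomorphism C B).

Definition pb_carrier : Type := {p : A * C | f p.1 = g p.2}.

Lemma pb_op_subproof (o : symbol Sg) (args : 'I_(arity o) -> pb_carrier) :
  f (op A o (fun i => (sval (args i)).1)) =
  g (op C o (fun i => (sval (args i)).2)).
Proof.
rewrite (hom_prop f) (hom_prop g); congr (op B o _).
by apply: functional_extensionality => i; exact: (svalP (args i)).
Qed.

Definition pb_algebra : algebra Sg :=
  @Algebra Sg pb_carrier (fun o args =>
    exist (fun p : A * C => f p.1 = g p.2) (_, _) (pb_op_subproof args)).

Definition pb_fst : homomorphism pb_algebra A :=
  @Homomorphism Sg pb_algebra A (fun p => (sval p).1) (fun _ _ => erefl).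

Definition pb_snd : homomorphism pb_algebra C :=
  @Homomorphism Sg pb_algebra C (fun p => (sval p).2) (fun _ _ => erefl).

Lemma pb_inj (x y : pb_algebra) :
  pb_fst x = pb_fst y -> pb_snd x = pb_snd y -> x = y.
Proof.
case: x y => [[a c] xP] [[a' c'] yP] /= ea ec.
by subst a' c'; rewrite (proof_irrelevance _ xP yP).
Qed.

Lemma pb_comm : hom_comp f pb_fst = hom_comp g pb_snd.
Proof.
by apply/hom_eq/functional_extensionality => x; exact: (svalP x).
Qed.

Section Pair.
Variables (X : algebra Sg) (a : homomorphism X A) (c : homomorphism X C).
Hypothesis ac : hom_comp f a = hom_comp g c.

Definition pb_pair_fun (x : X) : pb_algebra :=
  exist (fun p : A * C => f p.1 = g p.2) (a x, c x)
    (congr1 (fun h : homomorphism X B => h x) ac).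

Lemma pb_pair_is_hom : is_hom pb_pair_fun.
Proof.
by move=> o args; apply: pb_inj => /=; rewrite (hom_prop a, hom_prop c).
Qed.

Definition pb_pair : homomorphism X pb_algebra := Homomorphism pb_pair_is_hom.

End Pair.
End Pullback.

Section QuasivarietyCategory.
Variables (Sg : signature) (V : quasivariety Sg).
Local Notation K := (quasivariety_category V).

Lemma homomorphism_ext (A B : algebra Sg) (h k : homomorphism A B) :
  (forall x, h x = k x) -> h = k.
Proof. by move=> hk; apply/hom_eq/functional_extensionality. Qed.

Lemma homomorphism_app (A B : algebra Sg) (h k : homomorphism A B) :
  h = k -> forall x, h x = k x.
Proof. by move=> ->. Qed.

Variables (A B C : obj K) (f : hom A B) (g : hom C B).

Definition pb_obj : obj K :=
  exist (in_quasivariety V) (pb_algebra f g)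
    (in_quasivariety_jointly_injective (@pb_inj _ _ _ _ f g)
       (svalP A) (svalP C)).

Lemma pb_is_pullback :
  is_pullback (P := pb_obj) f g (pb_fst f g) (pb_snd f g).
Proof.
split=> [|X a c ac]; first exact: pb_comm.
exists (pb_pair ac); split=> [|u [ua uc]]; first by split; exact: hom_eq.
apply: homomorphism_ext => x; apply: pb_inj.
  exact: esym (homomorphism_app ua x).
exact: esym (homomorphism_app uc x).
Qed.

(** The universal property is compared with the concrete fibre product, whose elements are pairs:
    the canonical map from [P] to it has a left inverse, hence is injective. *)
Lemma pullback_jointly_injective (P : obj K) (p1 : hom P A) (p2 : hom P C) :
  is_pullback f g p1 p2 ->
  forall x y : sval P, p1 x = p1 y -> p2 x = p2 y -> x = y.
Proof.
case=> pc univ x y e1 e2.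
have [i [[i1 i2] _]] := univ pb_obj _ _ (pb_comm f g).
(* Both the identity and the round trip through [pb_obj] factor the cone [(p1, p2)] through itself,
   so uniqueness identifies them. *)
have [j [_ juniq]] := univ P _ _ pc.
have j_id : j = hom_id (sval P) by apply: juniq; split; exact: hom_eq.
have j_ip : j = hom_comp i (pb_pair pc).
  apply: juniq; split; apply: homomorphism_ext => z /=.
    exact: (homomorphism_app i1 (pb_pair pc z)).
  exact: (homomorphism_app i2 (pb_pair pc z)).
have ip z : i (pb_pair pc z) = z.
  by apply: (@homomorphism_app _ _ (hom_comp i (pb_pair pc)) (hom_id _));
     rewrite -j_ip.
by rewrite -(ip x) -(ip y); congr (hom_fun i _); apply: pb_inj.
Qed.

End QuasivarietyCategory.

Lemma goursat_terms_op3 (Sg : signature) (V : quasivariety Sg)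
    (w1 w2 : ternary_term Sg) (A : algebra Sg) :
  goursat_terms V w1 w2 -> in_quasivariety V A ->
  forall x z : A,
    [/\ term_op3 w1 x z z = x, term_op3 w1 x x z = term_op3 w2 x z z
      & term_op3 w2 x x z = z].
Proof.
move=> [h1 h2 h3] VA x z; pose v n := if n is 0 then x else z.
move: (h1 A VA v I) (h2 A VA v I) (h3 A VA v I).
by rewrite /holds_at /= !eval_app3.
Qed.

Lemma goursat_quasi_identity_op3 (Sg : signature) (w1 w2 : ternary_term Sg)
    (A : algebra Sg) (x x' a b c : A) :
  satisfies A (goursat_quasi_identity w1 w2) ->
  term_op3 w1 x a b = term_op3 w2 a b c ->
  term_op3 w1 x' a b = term_op3 w2 a b c ->
  term_op3 w2 b c x = term_op3 w1 a b c ->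
  term_op3 w2 b c x' = term_op3 w1 a b c -> x = x'.
Proof.
move=> sat e1 e2 e3 e4.
(* Only the variables 0 to 4 occur in the quasi-identity, so the default [x] of [nth] has no
   effect. *)
apply: (sat (fun n => nth x [:: x; x'; a; b; c] n)).
by rewrite /= /holds_at /= !eval_app3 /= e1 e2 e3 e4.
Qed.

Theorem proposition4p8 (Sg : signature) (V : quasivariety Sg)
    (w1 w2 : ternary_term Sg) :
  goursat V ->
  goursat_terms V w1 w2 ->
  weakly_maltsev
    (quasivariety_category (subquasivariety V (goursat_quasi_identity w1 w2))).
Proof.
move=> _ gt; set W := subquasivariety _ _.
(* The axioms of [W] include those of [V], so the Goursat identities persist in [W]. *)
have gtW (D : algebra Sg) : in_quasivariety W D -> forall x z : D,
    [/\ term_op3 w1 x z z = x, term_op3 w1 x x z = term_op3 w2 x z z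
      & term_op3 w2 x x z = z].
  by move=> WD; apply: (goursat_terms_op3 gt) => q Vq; apply: WD; left.
split=> A B C f r g s fr gs.
  by exists (pb_obj f g), (pb_fst f g), (pb_snd f g); exact: pb_is_pullback.
move=> P p1 p2 pb e1 e2 p1e1 p2e1 p1e2 p2e2 Z u v uv1 uv2.
have {}p1e1 := homomorphism_app p1e1; have {}p2e1 := homomorphism_app p2e1.
have {}p1e2 := homomorphism_app p1e2; have {}p2e2 := homomorphism_app p2e2.
have {}uv1 := homomorphism_app uv1; have {}uv2 := homomorphism_app uv2.
have {}fr := homomorphism_app fr.
have fg := homomorphism_app (proj1 pb).
have p_inj := pullback_jointly_injective pb.
rewrite /= in p1e1 p2e1 p1e2 p2e2 uv1 uv2 fr fg.
apply: homomorphism_ext => x.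
pose b := f (p1 x).
pose p := e1 (p1 x); pose q := e1 (r b); pose t := e2 (p2 x).
have [p1p p2p] : p1 p = p1 x /\ p2 p = s b by rewrite p1e1 p2e1.
have [p1q p2q] : p1 q = r b /\ p2 q = s b by rewrite p1e1 p2e1 fr.
(* Commutativity of the square gives [g (p2 x) = b]. *)
have [p1t p2t] : p1 t = r b /\ p2 t = p2 x by rewrite p1e2 p2e2 -fg.
(* With [x = (a, c)], the first coordinates are [w1(a, r b, r b)] and [w2(r b, r b, a)], both equal
   to [a]; the second are [w1(c, c, s b)] and [w2(c, s b, s b)]. *)
have eq1 : term_op3 w1 x t q = term_op3 w2 t q p.
  apply: p_inj; rewrite !hom_term_op3.
    rewrite p1p p1q p1t.
    have [-> _ _] := gtW _ (svalP A) (p1 x) (r b).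
    by have [_ _ ->] := gtW _ (svalP A) (r b) (p1 x).
  rewrite p2p p2q p2t.
  by have [_ -> _] := gtW _ (svalP C) (p2 x) (s b).
(* The roles of the coordinates are exchanged: the middle identity settles the first, and both sides
   of the second equal [c]. *)
have eq2 : term_op3 w2 q p x = term_op3 w1 t q p.
  apply: p_inj; rewrite !hom_term_op3.
    rewrite p1p p1q p1t.
    by have [_ -> _] := gtW _ (svalP A) (r b) (p1 x).
  rewrite p2p p2q p2t.
  have [_ _ ->] := gtW _ (svalP C) (s b) (p2 x).
  by have [-> _ _] := gtW _ (svalP C) (p2 x) (s b).
have [uvp uvq uvt] : [/\ u p = v p, u q = v q & u t = v t].
  by rewrite uv1 uv1 uv2.
(* The competing solutions are [u x] and [v x]; their parameters coincide because [u] and [v] agree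
   on [t], [q] and [p]. *)
apply: (@goursat_quasi_identity_op3 _ w1 w2 _ _ _ (u t) (u q) (u p)).
- by apply: (svalP Z); right.
- by rewrite -!hom_term_op3 eq1.
- by rewrite uvp uvq uvt -!hom_term_op3 eq1.
- by rewrite -!hom_term_op3 eq2.
- by rewrite uvp uvq uvt -!hom_term_op3 eq2.
Qed.
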